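(* Let $s\ge 1$ be an integer and let $P$, $Q$ be two $s\times s$ substochastic matrices. Then $$|\det(P-Q)|\le 1 .$$
   Context: An $s\times s$ matrix $P=(P_{ij})_{1\le i,j\le s}$ with nonnegative real entries is called substochastic if $\sum_{j=1}^sP_{ij}\le 1$ for all $i\in\{1,\ldots,s\}$. *)

(* Defs.v *)
From mathcomp Require Import all_boot all_order all_algebra.
From mathcomp Require Import reals.

Set Implicit Arguments.
Unset Strict Implicit.
Unset Printing Implicit Defensive.

Import Order.TTheory GRing.Theory Num.Theory.
Local Open Scope ring_scope.

Definition substochastic (R : realType) (s : nat) (P : 'M[R]_s) : Prop :=
  (forall i j, 0 <= P i j) /\ (forall i, \sum_(j < s) P i j <= 1).

(* Main.v *)
Require Import Defs.
From mathcomp Require Import all_boot all_order all_algebra.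
From mathcomp Require Import reals.

(** Expanding along the first row, det (P - Q) = sum_j (P 0 j - Q 0 j) c_j,
    where the cofactors c_j depend only on the other rows.  Nonnegative weights
    of total at most 1 can give the positive part at most max(0, max_j c_j) and
    the negative part at least min(0, min_j c_j), so it suffices that all |c_j|
    and all differences c_j - c_k are at most 1 ([weighted_diff_le1]).

    Both bounds come by induction on the size.  Up to sign, c_j is the
    determinant of a smaller difference of substochastic matrices, obtained by
    deleting a row and a column.  The difference c_j - c_k is, up to sign, also
    such a determinant: that of the matrix in which column j is merged into
    column k ([cofactor_sub]).  Merging columns preserves row sums, hence
    substochasticity, and this is what closes the induction.  Combinatorially,
    the merge is an edge contraction in the usual proof that the incidence
    matrix of a directed graph is totally unimodular. *)

Set Implicit Arguments.
Unset Strict Implicit.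
Unset Printing Implicit Defensive.

Import Order.TTheory GRing.Theory Num.Theory.
Local Open Scope ring_scope.

(** The number M = max(0, max_j c_j) separates the two sums: the first is at
    most M, and since M - 1 is nonpositive and below every c_k, the second is at
    least M - 1. *)
Lemma weighted_diff_le1 (R : realDomainType) (n : nat) (p q c : 'I_n -> R) :
    (forall j, 0 <= p j) -> \sum_j p j <= 1 ->
    (forall j, 0 <= q j) -> \sum_j q j <= 1 ->
    (forall j, `|c j| <= 1) -> (forall j k, c j - c k <= 1) ->
  \sum_j p j * c j - \sum_j q j * c j <= 1.
Proof.
move=> p0 p1 q0 q1 c1 cB.
pose M := \big[Num.max/0]_j c j.
have M0 : 0 <= M by apply: bigmax_ge_id.
have M1 : M <= 1.
  by apply: bigmax_le => // j _; apply: le_trans (ler_norm _) (c1 j).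
have Mc k : M - 1 <= c k.
  rewrite lerBlDr; apply: bigmax_le => [|j _]; last by rewrite addrC -lerBlDr.
  by have := c1 k; rewrite ler_norml -lerBlDr sub0r => /andP[].
have leM : \sum_j p j * c j <= M.
  apply: (@le_trans _ _ (\sum_j p j * M)).
    by apply: ler_sum => j _; rewrite ler_wpM2l // le_bigmax.
  by rewrite -mulr_suml ler_piMl.
have geM : M - 1 <= \sum_j q j * c j.
  apply: (@le_trans _ _ (\sum_j q j * (M - 1))); last first.
    by apply: ler_sum => j _; rewrite ler_wpM2l.
  by rewrite -mulr_suml ler_niMl // subr_le0.
by apply: le_trans (lerB leM geM) _; rewrite opprB addrC subrK.
Qed.

(** Right multiplication by [merge_mx j k] adds column j to column k. *)
Definition merge_mx (R : pzRingType) (n : nat) (j k : 'I_n) : 'M[R]_n :=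
  1%:M + delta_mx j k.

Lemma mul_merge_mxE (R : pzRingType) (m n : nat) (A : 'M[R]_(m, n))
    (j k : 'I_n) i l :
  (A *m merge_mx R j k) i l = A i l + A i j *+ (l == k).
Proof.
rewrite mulmxDr mulmx1 mxE; congr (_ + _); rewrite mxE.
rewrite (bigD1 j) //= big1 => [|h hj]; rewrite mxE.
  by rewrite eqxx addr0 /= mulr_natr.
by rewrite (negPf hj) mulr0.
Qed.

Lemma det_merge_mx (R : comPzRingType) (n : nat) (j k : 'I_n) :
  j != k -> \det (merge_mx R j k) = 1.
Proof.
move=> jk; rewrite (expand_det_row _ k) (bigD1 k) //= big1 => [|l lk].
  rewrite addr0 !mxE eqxx eq_sym (negPf jk) addr0 mul1r /cofactor.
  rewrite addnn -signr_odd odd_double mul1r -[RHS](@det1 _ n.-1).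
  congr (\det _); apply/matrixP=> a b; rewrite !mxE.
  by rewrite (inj_eq lift_inj) [_ == k]eq_sym (negPf (neq_lift k b)) andbF addr0.
by rewrite !mxE [k == l]eq_sym [k == j]eq_sym (negPf lk) (negPf jk) addr0 mul0r.
Qed.

(** Replace the first row of A by e_j - e_k, which makes the determinant the
    left-hand side.  Merging column j into column k keeps that determinant and
    turns the first row into e_j, which leaves a single cofactor. *)
Lemma cofactor_sub (R : comPzRingType) (n : nat) (A : 'M[R]_n.+1)
    (j k : 'I_n.+1) : j != k ->
  cofactor A 0 j - cofactor A 0 k = cofactor (A *m merge_mx R j k) 0 j.
Proof.
move=> jk.
pose B : 'M[R]_n.+1 :=
  \matrix_(i, l) if i == 0 then (l == j)%:R - (l == k)%:R else A i l.
have eqc (C D : 'M[R]_n.+1) l :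
    (forall i h, i != 0 -> C i h = D i h) -> cofactor C 0 l = cofactor D 0 l.
  move=> CD; congr (_ * \det _); apply/matrixP=> a b.
  by rewrite !mxE CD // eq_sym neq_lift.
have cAB l : cofactor A 0 l = cofactor B 0 l.
  by apply: eqc => i h i0; rewrite mxE (negPf i0).
have cM : cofactor (A *m merge_mx R j k) 0 j
        = cofactor (B *m merge_mx R j k) 0 j.
  by apply: eqc => i h i0; rewrite !mul_merge_mxE !mxE (negPf i0).
have detB : \det B = cofactor A 0 j - cofactor A 0 k.
  rewrite (expand_det_row _ 0) (bigD1 j) //= (bigD1 k) 1?eq_sym //= big1.
    rewrite addr0 !cAB !mxE !eqxx [k == j]eq_sym (negPf jk).
    by rewrite subr0 sub0r mul1r mulN1r.
  by move=> l /andP[lj lk]; rewrite !mxE eqxx (negPf lj) (negPf lk) subr0 mul0r.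
rewrite cM -detB -[LHS]mulr1 -(det_merge_mx R jk) -det_mulmx.
have row0 l : (B *m merge_mx R j k) 0 l = (l == j)%:R.
  by rewrite mul_merge_mxE !mxE !eqxx (negPf jk) subr0 subrK.
rewrite (expand_det_row _ 0) (bigD1 j) //= big1 => [|l lj].
  by rewrite row0 eqxx mul1r addr0.
by rewrite row0 (negPf lj) mul0r.
Qed.

Lemma norm_cofactor (R : numDomainType) (n : nat) (A : 'M[R]_n) (i j : 'I_n) :
  `|cofactor A i j| = `|\det (row' i (col' j A))|.
Proof. by rewrite normrM normrX normrN1 expr1n mul1r. Qed.

Lemma substochastic_minor (R : realType) (n : nat) (P : 'M[R]_n.+1)
    (i j : 'I_n.+1) : substochastic P -> substochastic (row' i (col' j P)).
Proof.
move=> [P0 P1]; split=> [a b|a]; first by rewrite !mxE.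
apply: le_trans (P1 (lift i a)); rewrite (bigD1_ord j) //=.
by under eq_bigr do rewrite !mxE; rewrite lerDr.
Qed.

(** Deleting column j after the merge leaves the row sums of P unchanged: the
    entry lost in column j reappears in column k. *)
Lemma substochastic_merge_minor (R : realType) (n : nat) (P : 'M[R]_n.+1)
    (i j k : 'I_n.+1) : j != k -> substochastic P ->
  substochastic (row' i (col' j (P *m merge_mx R j k))).
Proof.
move=> jk [P0 P1]; split=> [a b|a].
  by rewrite 2!mxE mul_merge_mxE addr_ge0 // mulrn_wge0.
apply: le_trans (P1 (lift i a)).
under eq_bigr do rewrite 2!mxE mul_merge_mxE.
rewrite big_split /= [leRHS](bigD1_ord j) //= addrC lerD2r.
have [k' -> _] := unlift_some jk.
rewrite (bigD1 k') //= eqxx big1 ?addr0 // => l lk.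
by rewrite (inj_eq lift_inj) (negPf lk).
Qed.

Lemma det_sub_substochastic (R : realType) (s : nat) (P Q : 'M[R]_s) :
  substochastic P -> substochastic Q -> `|\det (P - Q)| <= 1.
Proof.
elim: s P Q => [|s IH] P Q hP hQ; first by rewrite det_mx00 normr1.
pose c j := cofactor (P - Q) 0 j.
have c1 j : `|c j| <= 1.
  rewrite norm_cofactor !linearB.
  by apply: IH; apply: substochastic_minor.
have cB j k : c j - c k <= 1.
  have [->|jk] := eqVneq j k; first by rewrite subrr.
  apply: le_trans (ler_norm _) _.
  rewrite (cofactor_sub _ jk) norm_cofactor mulmxBl !linearB.
  by apply: IH; apply: substochastic_merge_minor.
have -> : \det (P - Q) = \sum_j P 0 j * c j - \sum_j Q 0 j * c j.
  rewrite (expand_det_row _ 0) -sumrB.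
  by apply: eq_bigr => j _; rewrite !mxE mulrBl.
case: hP hQ => [P0 P1] [Q0 Q1].
by rewrite ler_norml lerNl opprB; apply/andP; split; apply: weighted_diff_le1.
Qed.

Theorem theorem4p1 (R : realType) (s : nat) (P Q : 'M[R]_s)
    (hs : (1 <= s)%N) (hP : substochastic P) (hQ : substochastic Q) :
  `|\det (P - Q)| <= 1.
Proof. exact: det_sub_substochastic. Qed.
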